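(* For any $f,g\in Cl(\widetilde E)$, $\overline{f\circ g}=\overline g\circ\overline f$.
   Context: $S$ is an oriented surface of genus $g$ with $n$ punctures, $3g-3+n\ge 1$. $Mod(S)$ is its mapping class group (isotopy classes of orientation-preserving homeomorphisms of $S$). $\mathcal S$ is the set of isotopy classes of essential simple closed curves on $S$, $i(\cdot,\cdot)$ the geometric intersection number, $R_{+}=(0,\infty)$, $R_{\ge0}=[0,\infty)$. The space $\mathcal{MF}$ of measured foliations is the closure of the image of $R_+\times\mathcal S\to R_{\ge0}^{\mathcal S}$, $t\alpha\mapsto t\,i(\alpha,\cdot)$, in $R_{\ge0}^{\mathcal S}$ with the topology of pointwise convergence; it contains $0$, and $R_+$ acts on it by multiplication. Setting $i(t\alpha,s\beta)=ts\,i(\alpha,\beta)$, the intersection number extends continuously to $i:\mathcal{MF}\times\mathcal{MF}\to R_{\ge0}$. $Mod(S)$ acts on $\mathcal{MF}$ by push-forward; each $f\in Mod(S)$ acts as a homogeneous continuous map. A map $f:\mathcal{MF}\to\mathcal{MF}$ is homogeneous if $f(kF)=kf(F)$ for all $k\ge0$, $F\in\mathcal{MF}$. $\Omega(\mathcal{MF})$ is the set of homogeneous (Borel) measurable maps $\mathcal{MF}\to\mathcal{MF}$ with the topology of pointwise convergence. $R_+$ acts by $(kf)(F)=kf(F)$. $P\Omega(\mathcal{MF})=(\Omega(\mathcal{MF})-\{0\})/R_+$, with projection $\pi$. $E\subseteq P\Omega(\mathcal{MF})$ is the image of $Mod(S)$ under $f\mapsto\pi(f)$. $\widetilde E=\pi^{-1}(E)=\{kf: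 k>0, f\in Mod(S)\}$, and $Cl(\widetilde E)$ is its closure in $\Omega(\mathcal{MF})$; it is closed under composition. For $f\in Cl(\widetilde E)$, the conjugate $\overline f$ is the unique element of $Cl(\widetilde E)$ such that $i(f(F),G)=i(F,\overline f(G))$ for all $F,G\in\mathcal{MF}$. *)

(* Defs.v *)
From HB Require Import structures.
From mathcomp Require Import all_boot all_order all_algebra.
From mathcomp Require Import all_classical all_reals all_analysis.

Set Implicit Arguments.
Unset Strict Implicit.
Unset Printing Implicit Defensive.

Import Order.TTheory GRing.Theory Num.Theory.
Import numFieldNormedType.Exports.
Local Open Scope classical_set_scope.
Local Open Scope ring_scope.

(* Maps out of the circle [R/Z] are represented by 1-periodic maps out of [R]. *)
Definition is_loop (R : realType) (T : topologicalType) (c : R -> T) : Prop :=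
  continuous c /\ forall t, c (t + 1) = c t.

Definition simple_loop (R : realType) (T : topologicalType) (c : R -> T) : Prop :=
  is_loop c /\ {in `[0, 1[ &, injective c}.

(* The homotopy parameter ranges over [R] instead of [[0, 1]]: a homotopy over
   [[0, 1]] extends to [R] by constants. The same convention is used for
   isotopies below. *)
Definition freely_homotopic (R : realType) (T : topologicalType)
    (c d : R -> T) : Prop :=
  exists H : R -> R -> T,
    [/\ continuous (fun p : R * R => H p.1 p.2),
        forall s t, H s (t + 1) = H s t,
        H 0 =1 c
      & H 1 =1 d].

Definition nullhomotopic (R : realType) (T : topologicalType) (c : R -> T) : Prop :=
  exists x : T, freely_homotopic c (fun=> x).

(* Homotopic to a puncture: the loop can be pushed out of every compact set.
   On a closed surface this never happens. *)
Definition peripheral (R : realType) (T : topologicalType) (c : R -> T) : Prop :=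
  forall K : set T, compact K ->
    exists2 d : R -> T, freely_homotopic c d & forall t, ~ K (d t).

Definition simple_closed_curve (R : realType) (T : topologicalType)
    (a : set T) : Prop :=
  exists2 c : R -> T, simple_loop c & a = range c.

Definition essential_curve (R : realType) (T : topologicalType)
    (a : set T) : Prop :=
  exists c : R -> T,
    [/\ simple_loop c, a = range c, ~ nullhomotopic c & ~ peripheral c].

(* [c] winds [m] times around [z]: polar coordinates of [c] centred at [z]
   have a continuous argument which increases by [2 m pi] in one period. *)
Definition winding (R : realType) (c : R -> R * R) (z : R * R) (m : int) : Prop :=
  exists r theta : R -> R,
    [/\ continuous theta,
        forall t, 0 < r t,
        forall t, c t = (z.1 + r t * cos (theta t), z.2 + r t * sin (theta t))
      & forall t, theta (t + 1) = theta t + m%:~R * (2 * pi)].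

(* [h] has local degree [+1] at [x], read in the plane-valued local coordinates
   [u] at [x] and [v] at [h x]: near [x], winding numbers of loops around [x]
   are the winding numbers of their images around [h x]. *)
Definition orientation_preserving_at (R : realType) (T T' : topologicalType)
    (u : T -> R * R) (v : T' -> R * R) (h : T -> T') (x : T) : Prop :=
  exists2 U : set T, nbhs x U &
    forall c : R -> T, is_loop c -> (forall t, U (c t) /\ c t <> x) ->
    forall m : int,
      winding (u \o c) (u x) m <-> winding (v \o h \o c) (v (h x)) m.

Record chart (R : realType) (T : topologicalType) := Chart {
  chart_dom : set T;
  chart_map :> T -> R * R }.

(* A homeomorphism from an open set onto an open subset of the plane; the
   values of [chart_map] outside of [chart_dom] are irrelevant. *)
Definition is_chart (R : realType) (T : topologicalType) (u : chart R T) : Prop :=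
  [/\ open (chart_dom u),
      {in chart_dom u &, injective u},
      {in chart_dom u, continuous u}
    & forall V : set T, open V -> V `<=` chart_dom u -> open (u @` V)].

Definition oriented_atlas (R : realType) (T : topologicalType)
    (A : set (chart R T)) : Prop :=
  [/\ forall u, A u -> is_chart u,
      forall x, exists2 u, A u & chart_dom u x
    & forall u v x, A u -> A v -> chart_dom u x -> chart_dom v x ->
        orientation_preserving_at u v id x].

Definition closed_oriented_surface (R : realType) (M : topologicalType)
    (B : set (chart R M)) : Prop :=
  [/\ oriented_atlas B, hausdorff_space M, compact [set: M]
    & connected [set: M]].

Definition nonseparating_curves (R : realType) (M : topologicalType)
    (k : nat) : Prop :=
  exists c : 'I_k -> set M,
    [/\ forall j, simple_closed_curve R (c j),
        trivIset setT c
      & connected (~` (\bigcup_j c j))].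

(* The genus of a closed orientable surface is the maximal number of pairwise
   disjoint simple closed curves whose union does not separate it. *)
Definition has_genus (R : realType) (M : topologicalType) (g : nat) : Prop :=
  nonseparating_curves R M g /\
  forall k, nonseparating_curves R M k -> (k <= g)%N.

(* [S], oriented by the atlas [A], is homeomorphic to a closed surface of genus
   [g] minus [n] points. *)
Definition surface_of_type (R : realType) (S : topologicalType)
    (A : set (chart R S)) (g n : nat) : Prop :=
  oriented_atlas A /\
  exists (M : topologicalType) (B : set (chart R M)) (e : S -> M),
    [/\ closed_oriented_surface B, has_genus R M g,
        [/\ continuous e, injective e & forall V : set S, open V -> open (e @` V)]
      & ((~` range e) #= `I_n)%card].

Record homeo (T : topologicalType) := Homeo {
  homeo_fun :> T -> T;
  homeo_invfun : T -> T;
  homeoK : cancel homeo_fun homeo_invfun;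
  homeoVK : cancel homeo_invfun homeo_fun;
  homeo_continuous : continuous homeo_fun;
  homeoV_continuous : continuous homeo_invfun }.

Definition homeo_id (T : topologicalType) : homeo T :=
  @Homeo T id id (fun _ => erefl) (fun _ => erefl)
    (fun x => @cvg_id T (nbhs x)) (fun x => @cvg_id T (nbhs x)).

Definition homeo_inv (T : topologicalType) (h : homeo T) : homeo T :=
  Homeo (homeoVK h) (homeoK h) (@homeoV_continuous T h) (@homeo_continuous T h).

Definition homeo_comp (T : topologicalType) (h k : homeo T) : homeo T :=
  @Homeo T (h \o k) (homeo_invfun k \o homeo_invfun h)
    (can_comp (homeoK h) (homeoK k)) (can_comp (homeoVK k) (homeoVK h))
    (fun x => continuous_comp (@homeo_continuous T k x)
                              (@homeo_continuous T h (k x)))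
    (fun x => continuous_comp (@homeoV_continuous T h x)
                              (@homeoV_continuous T k (homeo_invfun h x))).

Definition isotopic (R : realType) (T : topologicalType) (h k : homeo T) : Prop :=
  exists H : R -> homeo T,
    [/\ continuous (fun p : R * T => H p.1 p.2), H 0 =1 h & H 1 =1 k].

Definition orientation_preserving (R : realType) (S : topologicalType)
    (A : set (chart R S)) (h : homeo S) : Prop :=
  forall (u v : chart R S) x, A u -> A v -> chart_dom u x -> chart_dom v (h x) ->
    orientation_preserving_at u v h x.

(* Mod(S); a mapping class is represented as a set of homeomorphisms. *)
Definition mapping_class (R : realType) (S : topologicalType)
    (A : set (chart R S)) : Type :=
  {m : set (homeo S) | exists2 h, orientation_preserving A h &
     m = [set k | orientation_preserving A k /\ isotopic R h k]}.

Definition isotopic_curves (R : realType) (T : topologicalType)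
    (a b : set T) : Prop :=
  exists2 h : homeo T, isotopic R (homeo_id T) h & b = h @` a.

Definition curve_class (R : realType) (T : topologicalType) : Type :=
  {c : set (set T) | exists2 a, essential_curve R a & c = isotopic_curves R a}.

Lemma for_continuous_pair (X Y Z : topologicalType) (f : X -> Y) (g : X -> Z)
    (x : X) : {for x, continuous f} -> {for x, continuous g} ->
  {for x, continuous (fun y => (f y, g y))}.
Proof. by move=> fx gx; exact: (cvg_pair fx gx). Qed.

Section curve_action.
Variables (R : realType) (T : topologicalType).
Implicit Types (h k : homeo T) (a b : set T).

Lemma image_homeo_comp h k a : homeo_comp h k @` a = h @` (k @` a).
Proof. by rewrite image_comp. Qed.

Lemma image_homeoK h a : homeo_inv h @` (h @` a) = a.
Proof.
by rewrite image_comp (_ : _ \o _ = id) ?image_id//; apply/funext => x/=;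
  rewrite homeoK.
Qed.

Lemma image_homeoVK h a : h @` (homeo_inv h @` a) = a.
Proof.
by rewrite image_comp (_ : _ \o _ = id) ?image_id//; apply/funext => x/=;
  rewrite homeoVK.
Qed.

Lemma essential_image h a : essential_curve R a -> essential_curve R (h @` a).
Proof.
have hc := @homeo_continuous T h; have hVc := @homeoV_continuous T h.
move=> [c [[[cc cp] cinj] -> nN nP]]; exists (h \o c); split.
- split; first split.
  + by move=> t; apply: continuous_comp; [exact: cc|exact: hc].
  + by move=> t /=; rewrite cp.
  + by move=> s t s01 t01 /(can_inj (homeoK h)); exact: cinj.
- by rewrite image_comp.
- move=> [x [H [Hc Hp H0 H1]]]; apply: nN; exists (homeo_invfun h x).
  exists (fun s t => homeo_invfun h (H s t)); split.
  + by move=> p; apply: continuous_comp; [exact: Hc|exact: hVc].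
  + by move=> s t; rewrite Hp.
  + by move=> t; rewrite H0 /= homeoK.
  + by move=> t; rewrite H1.
- move=> P; apply: nP => K Kc.
  have [|d [H [Hc Hp H0 H1]] Kd] := P (h @` K).
    by apply: continuous_compact => //; apply: continuous_subspaceT.
  exists (homeo_invfun h \o d); last first.
    by move=> t Kt; apply: (Kd t); exists (homeo_invfun h (d t)); rewrite // homeoVK.
  exists (fun s t => homeo_invfun h (H s t)); split.
  + by move=> p; apply: continuous_comp; [exact: Hc|exact: hVc].
  + by move=> s t; rewrite Hp.
  + by move=> t; rewrite H0 /= homeoK.
  + by move=> t; rewrite H1.
Qed.

Lemma isotopic_conj h k : isotopic R (homeo_id T) k ->
  isotopic R (homeo_id T) (homeo_comp h (homeo_comp k (homeo_inv h))).
Proof.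
move=> [H [Hc H0 H1]].
exists (fun s => homeo_comp h (homeo_comp (H s) (homeo_inv h))); split.
- move=> p; apply: (@continuous_comp _ _ _
    (fun p : R * T => H p.1 (homeo_invfun h p.2)) h); last exact: homeo_continuous.
  apply: (@continuous_comp _ _ _ (fun p : R * T => (p.1, homeo_invfun h p.2))
    (fun p : R * T => H p.1 p.2)); last exact: Hc.
  apply: for_continuous_pair => /=; first exact: cvg_fst.
  by apply: continuous_comp; [exact: cvg_snd|exact: homeoV_continuous].
- by move=> x /=; rewrite H0 /= homeoVK.
- by move=> x /=; rewrite H1.
Qed.

Lemma isotopic_id_comp h k : isotopic R (homeo_id T) h ->
  isotopic R (homeo_id T) k -> isotopic R (homeo_id T) (homeo_comp h k).
Proof.
move=> [H [Hc H0 H1]] [K [Kc K0 K1]].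
exists (fun s => homeo_comp (H s) (K s)); split.
- move=> p; apply: (@continuous_comp _ _ _ (fun p : R * T => (p.1, K p.1 p.2))
    (fun p : R * T => H p.1 p.2)); last exact: Hc.
  by apply: for_continuous_pair => /=; [exact: cvg_fst|exact: Kc].
- by move=> x /=; rewrite K0 H0.
- by move=> x /=; rewrite K1 H1.
Qed.

Lemma isotopic_divl h k : isotopic R h k ->
  isotopic R (homeo_id T) (homeo_comp (homeo_inv h) k).
Proof.
move=> [H [Hc H0 H1]]; exists (fun s => homeo_comp (homeo_inv h) (H s)); split.
- move=> p; apply: (@continuous_comp _ _ _ (fun p : R * T => H p.1 p.2)
    (homeo_invfun h)); [exact: Hc|exact: homeoV_continuous].
- by move=> x /=; rewrite H0 homeoK.
- by move=> x /=; rewrite H1.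
Qed.

Lemma isotopic_sym h k : isotopic R h k -> isotopic R k h.
Proof.
move=> [H [Hc H0 H1]]; exists (fun s => H (1 - s)); split.
- move=> p; apply: (@continuous_comp _ _ _ (fun p : R * T => (1 - p.1, p.2))
    (fun p : R * T => H p.1 p.2)); last exact: Hc.
  apply: for_continuous_pair => /=; last exact: cvg_snd.
  by apply: cvgB; [exact: cvg_cst|exact: cvg_fst].
- by rewrite subr0.
- by rewrite subrr.
Qed.

Lemma isotopic_refl h : isotopic R h h.
Proof.
exists (fun=> h); split=> // p.
by apply: continuous_comp; [exact: cvg_snd|exact: homeo_continuous].
Qed.

Lemma image_isotopic_curves h a :
  image (isotopic_curves R a) (fun b => h @` b) = isotopic_curves R (h @` a).
Proof.
apply/seteqP; split=> [_ [_ [k ki ->] <-]|_ [k ki ->]].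
  exists (homeo_comp h (homeo_comp k (homeo_inv h))); first exact: isotopic_conj.
  by rewrite !image_homeo_comp image_homeoK.
exists (homeo_inv h @` (k @` (h @` a))); last by rewrite image_homeoVK.
exists (homeo_comp (homeo_inv h) (homeo_comp k (homeo_inv (homeo_inv h)))).
  exact: isotopic_conj.
by rewrite !image_homeo_comp.
Qed.

Lemma curve_act_subproof h (c : curve_class R T) :
  exists2 a, essential_curve R a &
    image (sval c) (fun b => h @` b) = isotopic_curves R a.
Proof.
case: c => /= _ [a ea ->]; exists (h @` a); first exact: essential_image.
exact: image_isotopic_curves.
Qed.

Definition curve_act h (c : curve_class R T) : curve_class R T :=
  exist _ (image (sval c) (fun b => h @` b)) (curve_act_subproof h c).

Lemma curve_class_eq (c d : curve_class R T) : sval c = sval d -> c = d.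
Proof. exact: eq_sig_hprop. Qed.

Lemma curve_act_isotopic h k : isotopic R h k -> curve_act h = curve_act k.
Proof.
suff sub h' k' c : isotopic R h' k' ->
    sval (curve_act h' c) `<=` sval (curve_act k' c).
  move=> hk; apply/funext => c; apply/curve_class_eq/seteqP.
  by split; apply: sub; last apply: isotopic_sym.
move=> hk; case: c => /= _ [a ea ->] _ [_ [j ji ->] <-].
exists (homeo_inv k' @` (h' @` (j @` a))); last by rewrite image_homeoVK.
exists (homeo_comp (homeo_comp (homeo_inv k') h') j).
  by apply: isotopic_id_comp => //; exact/isotopic_divl/isotopic_sym.
by rewrite !image_homeo_comp.
Qed.

(* The infimum is a minimum, as it is taken over natural numbers. *)
Definition geometric_intersection (c d : curve_class R T) : R :=
  inf [set k%:R | k in [set k : nat |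
    exists a b, [/\ sval c a, sval d b & ((a `&` b) #= `I_k)%card]]].

End curve_action.

Definition weighted_curve (R : realType) (S : topologicalType)
    (t : R) (c : curve_class R S) : {ptws curve_class R S -> R} :=
  fun d => t * geometric_intersection c d.

(* Taking the closure in [R^S] or in its closed subset of nonnegative functions
   gives the same set. *)
Definition MF_set (R : realType) (S : topologicalType) :
    set {ptws curve_class R S -> R} :=
  closure [set F | exists (t : R) (c : curve_class R S),
                     0 < t /\ F = weighted_curve t c].

Definition MF (R : realType) (S : topologicalType) : Type :=
  set_type (@MF_set R S).

HB.instance Definition _ (R : realType) (S : topologicalType) :=
  Topological.copy (MF R S) (set_type (@MF_set R S)).

Definition MF_val (R : realType) (S : topologicalType) (F : MF R S) :
  curve_class R S -> R := set_val F.

(* [i] is the (unique) continuous extension of the intersection number to [MF]. *)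
Definition intersection_extension (R : realType) (S : topologicalType)
    (i : MF R S -> MF R S -> R) : Prop :=
  continuous (fun p : MF R S * MF R S => i p.1 p.2) /\
  forall (t s : R) (c d : curve_class R S) (F G : MF R S), 0 < t -> 0 < s ->
    MF_val F = weighted_curve t c -> MF_val G = weighted_curve s d ->
    i F G = t * s * geometric_intersection c d.

Definition homogeneous (R : realType) (S : topologicalType)
    (f : MF R S -> MF R S) : Prop :=
  forall (k : R) (F kF : MF R S), 0 <= k ->
    MF_val kF = (fun c => k * MF_val F c) ->
    MF_val (f kF) = (fun c => k * MF_val (f F) c).

Definition borel_measurable (T T' : topologicalType) (f : T -> T') : Prop :=
  forall B : set T', <<s @open T' >> B -> <<s @open T >> (f @^-1` B).

Definition Omega (R : realType) (S : topologicalType) :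
    set {ptws MF R S -> MF R S} :=
  [set f | homogeneous f /\ borel_measurable f].

Definition mapping_class_rep (R : realType) (S : topologicalType)
    (A : set (chart R S)) (m : mapping_class A) : homeo S :=
  s2val (cid2 (proj2_sig m)).

(* The action [F |-> i(F, m^-1 (-))]; by [curve_act_isotopic] it does not depend
   on the representative. *)
Definition push_forward (R : realType) (S : topologicalType)
    (A : set (chart R S)) (m : mapping_class A) (F : curve_class R S -> R) :
    curve_class R S -> R :=
  fun c => F (curve_act (homeo_inv (mapping_class_rep m)) c).

(* The preimage in [Omega - {0}] of the image of Mod(S) in [(Omega - {0}) / R_+]. *)
Definition Etilde (R : realType) (S : topologicalType) (A : set (chart R S)) :
    set {ptws MF R S -> MF R S} :=
  [set f | exists (k : R) (m : mapping_class A), 0 < k /\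
     forall F, MF_val (f F) = (fun c => k * push_forward m (MF_val F) c)].

(* The closure of [Etilde] in the subspace [Omega]. *)
Definition Cl_Etilde (R : realType) (S : topologicalType) (A : set (chart R S)) :
    set {ptws MF R S -> MF R S} :=
  @Omega R S `&` closure (Etilde A).

Definition is_conjugate (R : realType) (S : topologicalType)
    (A : set (chart R S)) (i : MF R S -> MF R S -> R)
    (f f' : {ptws MF R S -> MF R S}) : Prop :=
  Cl_Etilde A f' /\ forall F G, i (f F) G = i F (f' G).

(* The unique [f'] with [is_conjugate A i f f']; the default value [id] is
   irrelevant for [f] in [Cl_Etilde A]. *)
Definition conjugate (R : realType) (S : topologicalType)
    (A : set (chart R S)) (i : MF R S -> MF R S -> R)
    (f : {ptws MF R S -> MF R S}) : {ptws MF R S -> MF R S} :=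
  xget (id : {ptws MF R S -> MF R S}) (is_conjugate A i f).

(* Main.v *)
Require Import Defs.
From mathcomp Require Import all_boot all_order all_algebra.
From mathcomp Require Import all_classical all_reals all_analysis.

(** Write [Cl] for the closure of the positive multiples of mapping classes.
    A conjugate of [f] is an adjoint of [f] for the pairing [i], and adjoints
    are unique: if [F] is a curve [c], then [i F (f' G)] is the coordinate of
    [f' G] at [c], so [f'] is determined by [f] ([adjoint_unique]).  If [f']
    and [h'] are adjoints of [f] and [h], then
      [i (f (h F)) G = i (h F) (f' G) = i F (h' (f' G))],
    so it is enough that every [f] in [Cl] has an adjoint in [Cl] and that
    [h' \o f'] belongs to [Cl].

    Existence ([Cl_Etilde_adjoint]).  A multiple [k m] of a mapping class has
    the adjoint [k m^-1].  If such maps [e] tend to [f], then for each [G] and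
    each curve [c] the coordinate [i (e c) G] of the adjoint of [e] tends to
    [i (f c) G].  Since [MF] is closed under coordinatewise limits, the
    numbers [i (f c) G] are the coordinates of a point [f' G]; the adjoints of
    the [e] tend to [f'], and continuity of [i] makes [f'] adjoint to [f].
    Measurability does not survive arbitrary pointwise limits, but [f'] has
    the continuous coordinates [i (f c) -], hence it is continuous
    ([adjoint_continuous]).

    Composition ([Cl_Etilde_comp]).  Composition of maps is separately
    continuous for pointwise convergence as soon as the outer map is
    continuous, and adjoints are; so the closure inherits stability under
    composition from the multiples of mapping classes.  These are stable under
    composition and inversion because local degrees compose and the action on
    curves depends only on the isotopy class. *)

Set Implicit Arguments.
Unset Strict Implicit.
Unset Printing Implicit Defensive.

Import Order.TTheory GRing.Theory Num.Theory.
Import numFieldNormedType.Exports.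
Local Open Scope classical_set_scope.
Local Open Scope ring_scope.

(** * Closures and pointwise limits *)

Lemma closed_eqfun (R : realType) (T : topologicalType) (u v : T -> R) :
  continuous u -> continuous v -> closed [set x | u x = v x].
Proof.
move=> cu cv.
have -> : [set x | u x = v x] = (fun x => u x - v x) @^-1` [set 0].
  apply/seteqP; split=> x /=; first by move=> ->; rewrite subrr.
  by move=> /eqP; rewrite subr_eq0 => /eqP.
apply: (continuous_closedP _).1; last exact: closed_eq.
by move=> x; apply: cvgB; [exact: cu|exact: cv].
Qed.

Lemma continuous_scale (R : realType) (T : topologicalType) (k : R)
    (u : T -> R) : continuous u -> continuous (fun x => k * u x).
Proof. by move=> cu x; apply: cvgM; [exact: cvg_cst|exact: cu]. Qed.

Lemma continuous_borel_measurable (T T' : topologicalType) (f : T -> T') :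
  continuous f -> borel_measurable f.
Proof.
move=> cf B sB.
suff : <<s @open T' >> `<=` [set C | <<s @open T >> (f @^-1` C)] by exact.
have preo C : open C -> <<s @open T >> (f @^-1` C).
  by move=> oC; apply: sub_sigma_algebra; exact: open_comp.
apply: smallest_sub => //.
have [s0 sD sU] := smallest_sigma_algebra [set: T] (@open T).
split=> /=.
- by rewrite preimage_set0.
- by move=> C sC; have := sD _ sC; rewrite !setTD preimage_setC.
- by move=> C sC; rewrite preimage_bigcup; exact: sU.
Qed.

(** The form in which limits are taken below: a closed condition that holds on
    [A] passes to [closure A] through a continuous map. *)
Lemma closure_preimage (T U : topologicalType) (p : T -> U) (A : set T)
    (B : set U) : continuous p -> closed B -> (forall x, A x -> B (p x)) ->
  forall x, closure A x -> B (p x).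
Proof.
move=> cp cB AB x Ax.
have /closure_id cpB := (continuous_closedP _).1 cp B cB.
by move: (closureS (AB : A `<=` p @^-1` B) Ax); rewrite -cpB.
Qed.

Lemma ptws_cvgP (U : Type) (V : topologicalType)
    (F : set_system {ptws U -> V}) (f : {ptws U -> V}) : Filter F ->
  F --> f <-> forall x, (fun g : {ptws U -> V} => g x) @ F --> f x.
Proof.
move=> FF; split=> [/cvg_sup Ff x|Ff].
  apply: cvg_trans (cvg_app _ (Ff x)) _.
  exact: (@initial_continuous _ _ (fun g : {ptws U -> V} => g x)).
apply/cvg_sup => x B /= [_ [[W oW <-] Wf] WB].
by apply: filterS WB _; apply: Ff; exact: open_nbhs_nbhs.
Qed.

Lemma ptws_eval_continuous (U : Type) (V : topologicalType) (x : U) :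
  continuous (fun f : {ptws U -> V} => f x).
Proof. by move=> f; have /ptws_cvgP := @cvg_id _ (nbhs f); exact. Qed.

Lemma ptws_continuous (T : topologicalType) (U : Type) (V : topologicalType)
    (p : T -> {ptws U -> V}) :
  (forall x, continuous (fun t => p t x)) -> continuous p.
Proof.
move=> cp t; apply: (iffRL (@ptws_cvgP U V (p @ t) (p t) _)) => x.
exact: cp.
Qed.

(** * The space of measured foliations *)

Lemma MF_val_inj (R : realType) (S : topologicalType) (F G : MF R S) :
  MF_val F =1 MF_val G -> F = G.
Proof. by move=> FG; apply: val_inj; apply/funext. Qed.

Lemma MF_setP (R : realType) (S : topologicalType) (F : MF R S) :
  MF_set (MF_val F).
Proof. by have := set_valP F. Qed.

Lemma MF_exists (R : realType) (S : topologicalType)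
    (F : curve_class R S -> R) :
  MF_set (F : {ptws curve_class R S -> R}) -> exists G : MF R S, MF_val G = F.
Proof. by move=> FM; exists (exist _ F (mem_set FM)). Qed.

Lemma MF_cvgP (R : realType) (S : topologicalType) (T : Type)
    (P : set_system T) (f : T -> MF R S) (F : MF R S) : Filter P ->
  f @ P --> F <-> forall c, (fun x => MF_val (f x) c) @ P --> MF_val F c.
Proof.
move=> FP; pose v (G : MF R S) : {ptws curve_class R S -> R} := MF_val G.
have cv : continuous v by exact: initial_continuous.
split=> [fF c|fF].
  have vF : (v \o f) @ P --> v F by exact: cvg_comp fF (cv F).
  exact: cvg_comp vF (@ptws_eval_continuous _ R c (v F)).
have vF : (v \o f) @ P --> v F by apply/ptws_cvgP => c; exact: fF.
move=> B /= [_ [[W oW <-] WF] WB].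
by apply: filterS WB _; apply: vF; exact: open_nbhs_nbhs.
Qed.

Lemma MF_val_continuous (R : realType) (S : topologicalType)
    (c : curve_class R S) : continuous (fun F : MF R S => MF_val F c).
Proof. by move=> F; have /MF_cvgP := @cvg_id _ (nbhs F); exact. Qed.

Lemma MF_continuous (R : realType) (S : topologicalType) (T : topologicalType)
    (p : T -> MF R S) :
  (forall c, continuous (fun t => MF_val (p t) c)) -> continuous p.
Proof.
move=> cp t; apply: (iffRL (@MF_cvgP R S T (nbhs t) p (p t) _)) => c.
exact: cp.
Qed.

(** Weighted curves are dense in [MF]: the closure that defines [MF] is taken in
    the ambient product, and [MF] has the subspace topology. *)
Lemma MF_dense (R : realType) (S : topologicalType) (P : set (MF R S)) :
  closed P ->
  (forall t c F, 0 < t -> MF_val F = weighted_curve t c -> P F) ->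
  forall F, P F.
Proof.
move=> cP wP F; apply: contrapT => nPF.
have [/= W oW WP] : open (~` P) by exact: closed_openC.
have WF : nbhs (MF_val F : {ptws curve_class R S -> R}) W.
  apply: open_nbhs_nbhs; split=> //.
  by move: nPF; rewrite -[~ P F]/((~` P) F) -WP.
have [_ [[t [c [t0 ->]]] Wtc]] := @MF_setP R S F _ WF.
have [|G Gtc] := @MF_exists R S (weighted_curve t c).
  by apply: subset_closure; exists t, c.
have : (~` P) G by rewrite -WP; move: Wtc; rewrite -Gtc.
by apply; exact: wP t0 Gtc.
Qed.

Lemma MF_eq_on_curves (R : realType) (S : topologicalType)
    (u v : MF R S -> R) : continuous u -> continuous v ->
  (forall t c F, 0 < t -> MF_val F = weighted_curve t c -> u F = v F) ->
  u =1 v.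
Proof. by move=> cu cv; apply: MF_dense; exact: closed_eqfun. Qed.

(** * Homeomorphisms acting on curves *)

Section homeo_action.
Variables (R : realType) (S : topologicalType).
Implicit Types (h k : homeo S) (c d : curve_class R S).

Lemma curve_act_comp h k c :
  curve_act (homeo_comp h k) c = curve_act h (curve_act k c).
Proof.
apply: curve_class_eq; rewrite /= image_comp; apply: eq_imagel => a _.
exact: image_homeo_comp.
Qed.

Lemma curve_actK h : cancel (@curve_act R S h) (curve_act (homeo_inv h)).
Proof.
move=> c; apply: curve_class_eq; rewrite /= image_comp -[RHS]image_id.
by apply: eq_imagel => a _ /=; rewrite image_homeoK.
Qed.

Lemma curve_actVK h : cancel (curve_act (homeo_inv h)) (@curve_act R S h).
Proof.
move=> c; apply: curve_class_eq; rewrite /= image_comp -[RHS]image_id.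
by apply: eq_imagel => a _ /=; rewrite image_homeoVK.
Qed.

(** Inverting an isotopy pointwise might destroy joint continuity, so the
    isotopy is not inverted: the actions of [h] and [homeo_inv h] on curve
    classes are inverse bijections, and the first one is isotopy invariant. *)
Lemma curve_actV_isotopic h k : isotopic R h k ->
  @curve_act R S (homeo_inv h) = curve_act (homeo_inv k).
Proof.
move=> hk; apply/funext => c; apply: (can_inj (@curve_actK h)).
by rewrite curve_actVK (curve_act_isotopic hk) curve_actVK.
Qed.

Lemma geometric_intersection_sym c d :
  geometric_intersection c d = geometric_intersection d c.
Proof.
congr inf; apply/seteqP.
by split=> _ [k [a [b [ca db abk]]] <-]; exists k => //; exists b, a;
  rewrite setIC.
Qed.

Lemma geometric_intersection_act h c d :
  geometric_intersection (curve_act h c) (curve_act h d) =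
  geometric_intersection c d.
Proof.
have cardh a b : (h @` a `&` h @` b #= a `&` b)%card.
  have -> : h @` a `&` h @` b = h @` (a `&` b).
    apply/seteqP; split; last exact: sub_image_setI.
    move=> _ [[x ax <-] [y yb /(can_inj (homeoK h)) yx]].
    by exists x => //; split=> //; rewrite -yx.
  by apply: inj_card_eq => x y _ _; exact: (can_inj (homeoK h)).
congr inf; apply/seteqP; split=> _ [k [a [b [ca db abk]]] <-]; exists k => //.
  case: ca abk => a' ca <-; case: db => b' db <- abk; exists a', b'; split=> //.
  by apply: card_eq_trans abk; rewrite card_eq_sym.
exists (h @` a), (h @` b); split; [by exists a|by exists b|].
exact: card_eq_trans abk.
Qed.

Lemma curve_actVV h : @curve_act R S (homeo_inv (homeo_inv h)) = curve_act h.
Proof.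
by apply/funext => c; rewrite -{1}[c](curve_actK h) [LHS]curve_actK.
Qed.

Lemma geometric_intersection_adjoint h c d :
  geometric_intersection (curve_act h c) d =
  geometric_intersection c (curve_act (homeo_inv h) d).
Proof. by rewrite -{1}(curve_actVK h d) geometric_intersection_act. Qed.

End homeo_action.

(** * Mapping classes and their multiples *)

(** Winding numbers are compared in three charts, the middle one being any chart
    at [k x]; this is where the atlas has to cover the surface. *)
Lemma orientation_preserving_comp (R : realType) (S : topologicalType)
    (A : set (chart R S)) (h k : homeo S) :
  (forall x, exists2 u, A u & chart_dom u x) ->
  orientation_preserving A h -> orientation_preserving A k ->
  orientation_preserving A (homeo_comp h k).
Proof.
move=> Acov hA kA u v x Au Av ux vhkx; have [w Aw wkx] := Acov (k x).
have [U xU kU] := kA u w x Au Aw ux wkx.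
have [V kxV hV] := hA w v (k x) Aw Av wkx vhkx.
exists (U `&` k @^-1` V).
  by apply: filterI => //; exact: (@homeo_continuous _ k x).
move=> c [cc cp] cUV m; rewrite kU //; last first.
  by move=> t; have [[Uct _] ctx] := cUV t.
apply: (hV (k \o c)).
  split; last by move=> t /=; rewrite cp.
  by move=> t; apply: continuous_comp; [exact: cc|exact: homeo_continuous].
move=> t; have [[_ Vct] ctx] := cUV t; split=> //.
by move=> /(can_inj (homeoK k)).
Qed.

(** Near [x], a loop is the image under [h] of a loop near the preimage of [x],
    so the equivalence of winding numbers for [h] is read backwards. *)
Lemma orientation_preserving_inv (R : realType) (S : topologicalType)
    (A : set (chart R S)) (h : homeo S) :
  orientation_preserving A h -> orientation_preserving A (homeo_inv h).
Proof.
move=> hA u v x Au Av ux vhx.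
have uhhx : chart_dom u (h (homeo_inv h x)) by rewrite /= homeoVK.
have [U xU hU] := hA v u (homeo_inv h x) Av Au vhx uhhx.
exists (homeo_inv h @^-1` U); first exact: (@homeoV_continuous _ h x).
move=> c [cc cp] cU m.
have := hU (homeo_inv h \o c); rewrite /= homeoVK.
have -> : u \o h \o (homeo_invfun h \o c) = u \o c.
  by apply/funext => t /=; rewrite homeoVK.
move=> /(_ _ _ m) -> //.
- split; last by move=> t /=; rewrite cp.
  by move=> t; apply: continuous_comp; [exact: cc|exact: homeoV_continuous].
- move=> t; have [Uct ctx] := cU t; split=> //.
  by move=> /(can_inj (homeoVK h)).
Qed.

(** Replaces the chosen representative of a mapping class by an arbitrary
    orientation preserving homeomorphism. *)
Lemma EtildeP (R : realType) (S : topologicalType) (A : set (chart R S))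
    (f : {ptws MF R S -> MF R S}) :
  Etilde A f <-> exists k h, [/\ 0 < k, orientation_preserving A h &
    forall F c, MF_val (f F) c = k * MF_val F (curve_act (homeo_inv h) c)].
Proof.
split=> [[k [m [k0 fE]]]|[k [h [k0 hA fE]]]].
  exists k, (mapping_class_rep m); split=> //; last by move=> F c; rewrite fE.
  by rewrite /mapping_class_rep; case: cid2.
pose m : mapping_class A := exist _
  [set h' | orientation_preserving A h' /\ isotopic R h h']
  (ex_intro2 _ _ h hA erefl).
exists k, m; split=> // F; apply/funext => c; rewrite fE /push_forward.
suff hm : isotopic R (mapping_class_rep m) h.
  by rewrite (curve_actV_isotopic hm).
rewrite /mapping_class_rep; case: cid2 => /= h' h'A mE.
suff : [set j | orientation_preserving A j /\ isotopic R h' j] h by case.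
by rewrite -mE; split=> //; exact: isotopic_refl.
Qed.

Lemma Etilde_comp (R : realType) (S : topologicalType) (A : set (chart R S))
    (f e : {ptws MF R S -> MF R S}) :
  (forall x, exists2 u, A u & chart_dom u x) ->
  Etilde A f -> Etilde A e -> Etilde A (f \o e).
Proof.
move=> Acov /EtildeP [k [h [k0 hA fE]]] /EtildeP [l [j [l0 jA eE]]].
apply/EtildeP; exists (k * l), (homeo_comp h j); split.
- exact: mulr_gt0.
- exact: orientation_preserving_comp.
- move=> F c /=; rewrite fE eE mulrA; congr (_ * MF_val F _).
  apply: (can_inj (@curve_actK R S (homeo_comp h j))).
  by rewrite curve_actVK curve_act_comp !curve_actVK.
Qed.

Lemma scaled_weighted_curve (R : realType) (S : topologicalType) (k t : R)
    (h : homeo S) (c : curve_class R S) :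
  (fun d => k * weighted_curve t c (curve_act (homeo_inv h) d)) =
  weighted_curve (k * t) (curve_act h c).
Proof.
apply/funext => d.
by rewrite /weighted_curve geometric_intersection_adjoint mulrA.
Qed.

(** Scaling and pushing forward are continuous on all functions of curves and
    map weighted curves to weighted curves, hence preserve their closure. *)
Lemma scaled_act_exists (R : realType) (S : topologicalType) (k : R)
    (h : homeo S) : 0 < k -> exists f : MF R S -> MF R S,
  forall F c, MF_val (f F) c = k * MF_val F (curve_act (homeo_inv h) c).
Proof.
move=> k0.
pose p (F : {ptws curve_class R S -> R}) : {ptws curve_class R S -> R} :=
  fun c => k * F (curve_act (homeo_inv h) c).
suff pM F : exists G : MF R S, MF_val G = p (MF_val F).
  have [f fE] := choice pM; exists f => F c; by rewrite fE.
apply: MF_exists; apply: (closure_preimage (p := p)) (@MF_setP R S F).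
- apply: ptws_continuous => c.
  by apply: continuous_scale; exact: ptws_eval_continuous.
- exact: closed_closure.
- move=> _ [t [c [t0 ->]]]; apply: subset_closure.
  exists (k * t), (curve_act h c); split; first exact: mulr_gt0.
  exact: scaled_weighted_curve.
Qed.

Lemma scaled_act_continuous (R : realType) (S : topologicalType) (k : R)
    (h : homeo S) (f : MF R S -> MF R S) :
  (forall F c, MF_val (f F) c = k * MF_val F (curve_act (homeo_inv h) c)) ->
  continuous f.
Proof.
move=> fE; apply: MF_continuous => c.
under eq_fun do rewrite fE.
exact: continuous_scale (@MF_val_continuous _ _ _).
Qed.

(** * The intersection number *)

Section intersection.
Variables (R : realType) (S : topologicalType) (A : set (chart R S)).
Variables (i : MF R S -> MF R S -> R) (hi : intersection_extension i).

Lemma intersection_continuous (T : topologicalType) (u v : T -> MF R S) :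
  continuous u -> continuous v -> continuous (fun x => i (u x) (v x)).
Proof.
move=> cu cv x; apply: (@continuous_comp _ _ _ (fun x => (u x, v x))
  (fun p : MF R S * MF R S => i p.1 p.2)); last exact: hi.1.
by apply: for_continuous_pair; [exact: cu|exact: cv].
Qed.

(** The coordinates of a foliation are its intersection numbers with curves;
    through this formula [i] determines points of [MF]. *)
Lemma intersection_curve (t : R) (c : curve_class R S) (F G : MF R S) : 0 < t ->
  MF_val F = weighted_curve t c -> i F G = t * MF_val G c.
Proof.
move=> t0 Ftc; move: G; apply: MF_eq_on_curves.
- apply: intersection_continuous; last by move=> G; exact: cvg_id.
  exact: cst_continuous.
- by apply: continuous_scale; exact: MF_val_continuous.
- move=> s d G s0 Gsd; rewrite (hi.2 t s c d) // Gsd /weighted_curve mulrA.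
  by rewrite geometric_intersection_sym.
Qed.

Lemma curve_exists (c : curve_class R S) :
  exists F : MF R S, MF_val F = weighted_curve 1 c.
Proof. by apply: MF_exists; apply: subset_closure; exists 1, c. Qed.

Definition adjoint (f f' : MF R S -> MF R S) :=
  forall F G, i (f F) G = i F (f' G).

Lemma adjoint_val (f f' : MF R S -> MF R S) (c : curve_class R S) (F : MF R S) :
  adjoint f f' -> MF_val F = weighted_curve 1 c ->
  forall G, MF_val (f' G) c = i (f F) G.
Proof.
by move=> ff' Fc G; rewrite ff' (intersection_curve _ ltr01 Fc) mul1r.
Qed.

Lemma adjoint_unique (f f1 f2 : MF R S -> MF R S) :
  adjoint f f1 -> adjoint f f2 -> f1 = f2.
Proof.
move=> ff1 ff2; apply/funext => G; apply: MF_val_inj => c.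
have [F Fc] := curve_exists c.
by rewrite (adjoint_val ff1 Fc) (adjoint_val ff2 Fc).
Qed.

(** The coordinate of [f' G] at a curve [c] is [i (f c) G], where [f c] is a
    fixed foliation; so continuity of [i] alone is enough. *)
Lemma adjoint_continuous (f f' : MF R S -> MF R S) :
  adjoint f f' -> continuous f'.
Proof.
move=> ff'; apply: MF_continuous => c; have [F Fc] := curve_exists c.
under eq_fun do rewrite (adjoint_val ff' Fc).
apply: (intersection_continuous (u := fun=> f F) (v := id)).
  exact: cst_continuous.
by move=> H; exact: cvg_id.
Qed.

(** [k m] and [k m^-1] are adjoint: on curves this is the invariance of
    geometric intersection, and both sides are continuous in [F]. *)
Lemma Etilde_adjoint (f : {ptws MF R S -> MF R S}) : Etilde A f ->
  exists f' : {ptws MF R S -> MF R S}, Etilde A f' /\ adjoint f f'.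
Proof.
move=> /EtildeP [k [h [k0 hA fE]]].
have [f' f'E] := @scaled_act_exists R S k (homeo_inv h) k0.
exists f'; split.
  apply/EtildeP; exists k, (homeo_inv h); split=> //.
  exact: orientation_preserving_inv.
move=> F G; move: F; apply: MF_eq_on_curves.
- apply: intersection_continuous; last exact: cst_continuous.
  exact: scaled_act_continuous fE.
- apply: intersection_continuous; last exact: cst_continuous.
  by move=> F; exact: cvg_id.
- move=> t c F t0 Ftc.
  have fFtc : MF_val (f F) = weighted_curve (k * t) (curve_act h c).
    by rewrite -scaled_weighted_curve -Ftc; apply/funext => d; rewrite fE.
  rewrite (intersection_curve _ t0 Ftc).
  rewrite (intersection_curve _ _ fFtc) ?mulr_gt0 //.
  by rewrite f'E curve_actVV mulrCA mulrA.
Qed.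

(** Homogeneity is a family of equations between coordinates at fixed points,
    hence a closed condition. *)
Lemma closure_Etilde_homogeneous (f : {ptws MF R S -> MF R S}) :
  closure (Etilde A) f -> homogeneous f.
Proof.
move=> fE k F kF _ kFE; apply/funext => c.
pose p (e : {ptws MF R S -> MF R S}) := e.
apply: (closure_preimage (p := p)
  (B := [set e | MF_val (e kF) c = k * MF_val (e F) c])) fE.
- by move=> e; exact: cvg_id.
- have ce G : continuous (fun e : {ptws MF R S -> MF R S} => MF_val (e G) c).
    move=> e; apply: (@continuous_comp _ _ _
      (fun e : {ptws MF R S -> MF R S} => e G) (fun F => MF_val F c)).
      exact: ptws_eval_continuous.
    exact: MF_val_continuous.
  apply: closed_eqfun; first exact: ce.
  by apply: continuous_scale; exact: ce.
- move=> e /EtildeP [l [h [l0 hA eE]]] /=.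
  by rewrite !eE kFE mulrCA.
Qed.

(** The adjoint of [f] is the limit of adjoints [C e] along the trace [P] on the
    multiples of mapping classes of the neighbourhoods of [f]. *)
Lemma Cl_Etilde_adjoint (f : {ptws MF R S -> MF R S}) : Cl_Etilde A f ->
  exists f' : {ptws MF R S -> MF R S}, Cl_Etilde A f' /\ adjoint f f'.
Proof.
move=> [_ clf].
have /choice [C CE] : forall e : {ptws MF R S -> MF R S}, exists e',
    Etilde A e -> Etilde A e' /\ adjoint e e'.
  move=> e; have [/Etilde_adjoint [e' ee']|nE] := pselect (Etilde A e).
    by exists e'.
  by exists e => /nE.
pose P := within (Etilde A) (nbhs f).
have PP : ProperFilter P by exact: within_nbhs_proper.
have Pf : P --> f by exact: cvg_within.
have PE : \forall e \near P, Etilde A e by exact: withinT.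
have ei F G : (fun e : {ptws MF R S -> MF R S} => i (e F) G) @ P --> i (f F) G.
  suff ci : continuous (fun e : {ptws MF R S -> MF R S} => i (e F) G).
    exact: cvg_comp Pf (ci f).
  apply: intersection_continuous; first exact: ptws_eval_continuous.
  exact: cst_continuous.
have /choice [f' f'E] : forall G, exists G' : MF R S, forall c F,
    MF_val F = weighted_curve 1 c -> MF_val G' c = i (f F) G.
  (* The function with coordinates [i (f c) G] is a limit of points of [MF],
     as [p e] is the coordinate function of [C e G]. *)
  move=> G; have /choice [g gE] := curve_exists.
  pose p (e : {ptws MF R S -> MF R S}) : {ptws curve_class R S -> R} :=
    fun c => i (e (g c)) G.
  have [|G' G'E] := @MF_exists R S (p f).
    apply: (closure_preimage (p := p) _ (@closed_closure _ _) _ clf).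
      apply: ptws_continuous => c; apply: intersection_continuous.
        exact: ptws_eval_continuous.
      exact: cst_continuous.
    move=> e eE; have [_ ee'] := CE e eE.
    suff -> : p e = MF_val (C e G) by exact: MF_setP.
    by apply/funext => c; rewrite (adjoint_val ee' (gE c)).
  exists G' => c F Fc; rewrite G'E /p; congr (i (f _) G).
  by apply: MF_val_inj => d; rewrite gE Fc.
have Cf' G : (fun e => C e G) @ P --> f' G.
  apply: (iffRL (@MF_cvgP R S _ P (C^~ G) (f' G) _)) => c.
  have [F Fc] := curve_exists c.
  rewrite (f'E G c F Fc); apply: cvg_trans (ei F G).
  apply: near_eq_cvg; near=> e.
  have [_ ee'] : Etilde A (C e) /\ adjoint e (C e) by apply: CE; near: e.
  by rewrite (adjoint_val ee' Fc).
have ff' : adjoint f f'.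
  move=> F G.
  have iC : (fun e => i F (C e G)) @ P --> i F (f' G).
    suff ci : continuous (i F) by exact: cvg_comp (Cf' G) (ci (f' G)).
    apply: intersection_continuous; first exact: cst_continuous.
    by move=> e; exact: cvg_id.
  apply: (cvg_unique _ (ei F G)); first exact: norm_hausdorff.
  apply: cvg_trans iC; apply: near_eq_cvg; near=> e.
  have [_ ee'] : Etilde A (C e) /\ adjoint e (C e) by apply: CE; near: e.
  by rewrite ee'.
have clf' : closure (Etilde A) f'.
  have CPf' : C @ P --> (f' : {ptws MF R S -> MF R S}).
    exact: (iffRL (@ptws_cvgP _ _ (C @ P) f' _)).
  apply: (@closed_cvg _ _ _ PP C _ (@closed_closure _ (Etilde A)) _ f' CPf').
  near=> e; apply: subset_closure.
  have [Ce _] : Etilde A (C e) /\ adjoint e (C e) by apply: CE; near: e.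
  exact: Ce.
exists f'; split=> //; split=> //; split.
  exact: closure_Etilde_homogeneous.
by apply: continuous_borel_measurable; exact: adjoint_continuous ff'.
Unshelve. all: by end_near.
Qed.

(** The limits are taken one after the other, since composition is not jointly
    continuous.  The inner map is approximated with [f] fixed, which uses that
    [f] is continuous; then [f] is approximated with the inner map a fixed
    multiple of a mapping class. *)
Lemma Cl_Etilde_comp (f e : {ptws MF R S -> MF R S}) :
  (forall x, exists2 u, A u & chart_dom u x) -> continuous f ->
  Cl_Etilde A f -> Cl_Etilde A e -> Cl_Etilde A (f \o e).
Proof.
move=> Acov cf [[fh fm] clf] [[eh em] cle].
split; first split.
- by move=> k F kF k0 kFE; apply: fh => //; exact: eh.
- by move=> B sB; exact: em (fm _ sB).
- pose p (e : {ptws MF R S -> MF R S}) : {ptws MF R S -> MF R S} := f \o e.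
  apply: (closure_preimage (p := p) _ (@closed_closure _ _) _ cle).
    apply: ptws_continuous => F e'.
    apply: (@continuous_comp _ _ _ (fun e : {ptws MF R S -> MF R S} => e F) f).
      exact: ptws_eval_continuous.
    exact: cf.
  move=> e' e'E.
  pose q (f : {ptws MF R S -> MF R S}) : {ptws MF R S -> MF R S} := f \o e'.
  apply: (closure_preimage (p := q) _ (@closed_closure _ _) _ clf).
    by apply: ptws_continuous => F; exact: ptws_eval_continuous.
  by move=> f' f'E; apply: subset_closure; exact: Etilde_comp.
Qed.

Lemma conjugate_eq (f f' : {ptws MF R S -> MF R S}) :
  Cl_Etilde A f' -> adjoint f f' -> conjugate A i f = f'.
Proof.
move=> f'E ff'; apply: xget_unique; first by split.
by move=> f'' [_ ff'']; exact: adjoint_unique ff'' ff'.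
Qed.

End intersection.

(** * Conjugates of composites *)

Theorem proposition4p5 (R : realType) (S : topologicalType)
    (A : set (chart R S)) (g n : nat)
    (hS : surface_of_type A g n)
    (hgn : 1 <= 3 * g%:Z - 3 + n%:Z)
    (i : MF R S -> MF R S -> R) (hi : intersection_extension i)
    (f h : {ptws MF R S -> MF R S})
    (hf : Cl_Etilde A f) (hh : Cl_Etilde A h) :
  conjugate A i (f \o h) = conjugate A i h \o conjugate A i f.
Proof.
have [[_ Acov _] _] := hS.
have [f' [f'E ff']] := Cl_Etilde_adjoint hi hf.
have [h' [h'E hh']] := Cl_Etilde_adjoint hi hh.
rewrite (conjugate_eq hi f'E ff') (conjugate_eq hi h'E hh').
apply: (conjugate_eq hi); last by move=> F G /=; rewrite ff' hh'.
by apply: Cl_Etilde_comp => //; exact: adjoint_continuous hi _ _ hh'.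
Qed.
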